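(* For every $n\ge 1$, the set $\{x_\lambda : \lambda\vdash n\}$ is a basis for $\mathrm{Sym}^n$. Moreover, if $\lambda$ and $\gamma$ are integer partitions, then $$x_\lambda x_\gamma=x_{\lambda|\gamma}.$$
   Context: An integer partition $\lambda=\lambda_1\lambda_2\cdots\lambda_l\vdash n$ is a nonincreasing list of positive integers with sum $n$. For integer partitions $\lambda\vdash n$ and $\gamma\vdash m$, $\lambda|\gamma\vdash n+m$ is the integer partition whose parts are the parts of $\lambda$ together with those of $\gamma$ (with multiplicity). $\mathrm{Sym}=\bigoplus_{n\ge0}\mathrm{Sym}^n\subset\mathbb{Q}[[x_1,x_2,\dots]]$ is the algebra of symmetric functions over $\mathbb{Q}$ in commuting variables, and $\mathrm{Sym}^n$ its degree-$n$ homogeneous piece. A set partition $\pi\vdash[n]$ of $[n]=\{1,\dots,n\}$ is a collection of disjoint nonempty subsets (blocks) with union $[n]$. Set partitions of $[n]$ are ordered by refinement: $\sigma\le\pi$ if each block of $\sigma$ is contained in a block of $\pi$. $u$ is the Möbius function of this lattice: for $\sigma\le\pi$, $u(\sigma,\pi)=\prod_i(-1)^{k_i-1}(k_i-1)!$ where $k_i$ is the number of blocks of $\sigma$ contained in the $i$th block of $\pi$. For set partitions $\pi\vdash[n]$ and $\sigma\vdash[m]$, the slash product $\pi|\sigma\vdash[n+m]$ has as blocks those of $\pi$ together with the blocks of $\sigma$ shifted by $n$. $\llbracket n\rrbracket$ is the set partition of $[n]$ with one block, and for $\lambda=\lambda_1\cdots\lambda_l$, $\llbracket\lambda\rrbracket=\llbracket\lambda_1\rrbracket|\llbracket\lambda_2\rrbracket|\cdots|\llbracket\lambda_l\rrbracket$.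 In noncommuting variables $\mathbf{x}_1,\mathbf{x}_2,\dots$, for $\pi\vdash[n]$ let $p_\pi=\sum\mathbf{x}_{i_1}\cdots\mathbf{x}_{i_n}$ over all tuples of positive integers with $i_j=i_k$ whenever $j,k$ are in the same block of $\pi$, and let $x_\pi=\sum_{\sigma\leq\pi}u(\sigma,\pi)\,p_\sigma$. Let $\rho:\mathbb{Q}[[\mathbf{x}_1,\mathbf{x}_2,\dots]]\to\mathbb{Q}[[x_1,x_2,\dots]]$ be the algebra morphism letting the variables commute ($\mathbf{x}_i\mapsto x_i$). For an integer partition $\lambda$, the extra symmetric function in $\mathrm{Sym}$ is $$x_\lambda=\rho(x_{\llbracket\lambda\rrbracket}).$$ *)

(* Defs.v *)
From HB Require Import structures.
From mathcomp Require Import all_boot all_order all_algebra.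
From mathcomp Require Import finmap boolp functions.
From mathcomp.multinomials Require Import monalg.

Set Implicit Arguments.
Unset Strict Implicit.
Unset Printing Implicit Defensive.

Import GRing.Theory.
Local Open Scope ring_scope.

(* [splits m] lists the finitely many factorizations of [m], so that the
   Cauchy product of arbitrary functions on the monoid makes sense. *)
HB.mixin Record MonomialDef_isLocallyFinite M of MonomialDef M := {
  splits : M -> {fset M * M};
  mem_splits : forall (m : M) (p : M * M),
    (p \in splits m) = (mmul p.1 p.2 == m)
}.

#[short(type="lfMonomType")]
HB.structure Definition LFMonomial :=
  { M of MonomialDef M & MonomialDef_isLocallyFinite M }.

#[short(type="lfConomType")]
HB.structure Definition LFConomial :=
  { M of LFMonomial M & ConomialDef M }.

(* The series [f] stands for the formal sum of the [f m *: m]. *)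
Definition series (M : monomType) := M -> rat.

HB.instance Definition _ (M : monomType) :=
  GRing.Lmodule.copy (series M) (M -> rat^o).

Lemma eq_big_allpairs (I1 J1 I2 J2 K : eqType)
    (s1 : seq I1) (t1 : I1 -> seq J1) (f1 : I1 -> J1 -> K)
    (s2 : seq I2) (t2 : I2 -> seq J2) (f2 : I2 -> J2 -> K) (F : K -> rat) :
    uniq [seq f1 i j | i <- s1, j <- t1 i] ->
    uniq [seq f2 i j | i <- s2, j <- t2 i] ->
    [seq f1 i j | i <- s1, j <- t1 i] =i [seq f2 i j | i <- s2, j <- t2 i] ->
  \sum_(i <- s1) \sum_(j <- t1 i) F (f1 i j) =
  \sum_(i <- s2) \sum_(j <- t2 i) F (f2 i j).
Proof.
move=> U1 U2 E.
transitivity (\sum_(k <- [seq f1 i j | i <- s1, j <- t1 i]) F k).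
  by rewrite big_allpairs_dep.
transitivity (\sum_(k <- [seq f2 i j | i <- s2, j <- t2 i]) F k).
  exact/perm_big/uniq_perm.
by rewrite big_allpairs_dep.
Qed.

Section SeriesRing.
Variable M : lfMonomType.
Implicit Types f g h : series M.

Definition series1 : series M := fun m => (m == mone)%:R.

Definition mulseries f g : series M :=
  fun m => \sum_(p <- splits m) f p.1 * g p.2.

Fact mulseriesA : associative mulseries.
Proof.
move=> f g h; apply/funext => m; rewrite /mulseries.
under eq_bigr do rewrite mulr_sumr.
under [RHS]eq_bigr do rewrite mulr_suml.
under eq_bigr do under eq_bigr do rewrite mulrA.
pose F (t : M * M * M) : rat := f t.1.1 * g t.1.2 * h t.2.
apply: (@eq_big_allpairs _ _ _ _ _ (splits m) (fun p => splits p.2)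
  (fun p q => (p.1, q.1, q.2)) (splits m) (fun p => splits p.1)
  (fun p q => (q.1, q.2, p.2)) F).
- apply: allpairs_uniq_dep => // -[[a b] [c d]] [[a' b'] [c' d']].
  move=> /allpairsPdep[p [q [ps qs E]]] /allpairsPdep[p' [q' [ps' qs' E']]].
  case: E => ? ?; case: E' => ? ?; subst.
  rewrite !mem_splits /= in qs qs'.
  by case=> -> Ec Ed; rewrite -(eqP qs) -(eqP qs') Ec Ed.
- apply: allpairs_uniq_dep => // -[[a b] [c d]] [[a' b'] [c' d']].
  move=> /allpairsPdep[p [q [ps qs E]]] /allpairsPdep[p' [q' [ps' qs' E']]].
  case: E => ? ?; case: E' => ? ?; subst.
  rewrite !mem_splits /= in qs qs'.
  by case=> Ec Ed ->; rewrite -(eqP qs) -(eqP qs') Ec Ed.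
- move=> [[a b] c]; apply/allpairsPdep/allpairsPdep.
  + case=> -[p1 p2] [[q1 q2] []]; rewrite !mem_splits /=.
    move=> /eqP Ep /eqP Eq [-> -> ->].
    exists (mmul p1 q1, q2), (p1, q1); rewrite !mem_splits /=.
    by rewrite -mulmA Eq Ep !eqxx.
  + case=> -[p1 p2] [[q1 q2] []]; rewrite !mem_splits /=.
    move=> /eqP Ep /eqP Eq [-> -> ->].
    exists (q1, mmul q2 p2), (q2, p2); rewrite !mem_splits /=.
    by rewrite mulmA Eq Ep !eqxx.
Qed.

Fact mul1series : left_id series1 mulseries.
Proof.
move=> f; apply/funext => m; rewrite /mulseries /series1.
rewrite (bigD1_seq (mone, m)) ?mem_splits ?fset_uniq ?mul1m //=.
rewrite eqxx mul1r big_seq_cond big1 ?addr0 // => -[a b] /=.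
rewrite mem_splits => /andP[/eqP/= <- ne].
by case: (eqVneq a mone) ne => [->|_ _]; rewrite ?mul1m ?eqxx // mul0r.
Qed.

Fact mulseries1 : right_id series1 mulseries.
Proof.
move=> f; apply/funext => m; rewrite /mulseries /series1.
rewrite (bigD1_seq (m, mone)) ?mem_splits ?fset_uniq ?mulm1 //=.
rewrite eqxx mulr1 big_seq_cond big1 ?addr0 // => -[a b] /=.
rewrite mem_splits => /andP[/eqP/= <- ne].
by case: (eqVneq b mone) ne => [->|_ _]; rewrite ?mulm1 ?eqxx // mulr0.
Qed.

Fact mulseriesDl : left_distributive mulseries +%R.
Proof.
move=> f g h; apply/funext => m; rewrite /mulseries.
transitivity (\sum_(p <- splits m) (f p.1 * h p.2 + g p.1 * h p.2)).
  by apply: eq_bigr => p _; exact: mulrDl.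
exact: big_split.
Qed.

Fact mulseriesDr : right_distributive mulseries +%R.
Proof.
move=> f g h; apply/funext => m; rewrite /mulseries.
transitivity (\sum_(p <- splits m) (f p.1 * g p.2 + f p.1 * h p.2)).
  by apply: eq_bigr => p _; exact: mulrDr.
exact: big_split.
Qed.

Fact series1_neq0 : series1 != 0.
Proof.
apply/eqP => /(congr1 (fun f => f mone)); rewrite /series1 eqxx.
by move/eqP; rewrite oner_eq0.
Qed.

HB.instance Definition _ := GRing.Zmodule_isNzRing.Build (series M)
  mulseriesA mul1series mulseries1 mulseriesDl mulseriesDr series1_neq0.

Fact mulseries_scaleAl (a : rat) f g : a *: (f * g) = (a *: f) * g.
Proof.
apply/funext => m; rewrite [LHS]mulr_sumr.
by apply: eq_bigr => p _; rewrite mulrA.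
Qed.

HB.instance Definition _ :=
  GRing.Lmodule_isLalgebra.Build rat (series M) mulseries_scaleAl.

Fact mulseries_scaleAr (a : rat) f g : a *: (f * g) = f * (a *: g).
Proof.
apply/funext => m; rewrite [LHS]mulr_sumr.
by apply: eq_bigr => p _; rewrite mulrCA.
Qed.

HB.instance Definition _ :=
  GRing.Lalgebra_isAlgebra.Build rat (series M) mulseries_scaleAr.

Lemma series1E m : (1 : series M) m = (m == mone)%:R.
Proof. by []. Qed.

Lemma seriesME f g m : (f * g) m = \sum_(p <- splits m) f p.1 * g p.2.
Proof. by []. Qed.

End SeriesRing.

Section SeriesComRing.
Variable M : lfConomType.
Implicit Types f g : series M.

Fact mulseriesC : commutative (@GRing.mul (series M)).
Proof.
move=> f g; apply/funext => m; rewrite !seriesME.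
rewrite [RHS](perm_big [seq (p.2, p.1) | p <- splits m]) /=; last first.
  apply: uniq_perm; rewrite ?map_inj_uniq ?fset_uniq //.
    by move=> [? ?] [? ?] [-> ->].
  move=> [a b]; rewrite mem_splits; apply/idP/mapP => [E|[[c d] + [-> ->]]].
    by exists (b, a); rewrite // mem_splits mulmC.
  by rewrite mem_splits mulmC.
by rewrite big_map; apply: eq_bigr => p _; rewrite mulrC.
Qed.

HB.instance Definition _ :=
  GRing.PzRing_hasCommutativeMul.Build (series M) mulseriesC.

End SeriesComRing.

Section FreeMonoid.
Local Open Scope fset_scope.
Implicit Type w : {fmonom nat}.

Definition fsplits w : {fset {fmonom nat} * {fmonom nat}} :=
  [fset (FMonom (take i w), FMonom (drop i w)) | i in iota 0 (size w).+1].

Fact mem_fsplits w p : (p \in fsplits w) = (mmul p.1 p.2 == w).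
Proof.
apply/imfsetP/eqP => [[i _ ->]|<-] /=.
  by apply/val_inj; rewrite /= fmM /= cat_take_drop.
exists (size p.1).
  suff: size p.1 \in iota 0 (size (mmul p.1 p.2)).+1 by [].
  by rewrite mem_iota fmM size_cat ltnS leq_addr.
by rewrite fmM take_size_cat // drop_size_cat // !fmK; case: p.
Qed.

HB.instance Definition _ :=
  MonomialDef_isLocallyFinite.Build {fmonom nat} mem_fsplits.

End FreeMonoid.

(* The commutative monomial obtained from a word. *)
Definition content (w : {fmonom nat}) : {cmonom nat} :=
  \big[mmul/mone]_(i <- w) ucm i.

Lemma contentE w i : content w i = count_mem i w.
Proof.
rewrite /content; elim: (w : seq nat) => [|j s IHs]; first by rewrite big_nil cm1.
by rewrite big_cons cmM cmU IHs.
Qed.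

Lemma contentM v w : content (mmul v w) = mmul (content v) (content w).
Proof. by apply/eqP/cmP => i; rewrite cmM !contentE fmM count_cat. Qed.

Section Words.
Local Open Scope fset_scope.
Implicit Type m : {cmonom nat}.

Definition cmonom_seq m : seq nat :=
  flatten [seq nseq (m i) i | i <- finsupp m].

Lemma count_cmonom_seq m i : count_mem i (cmonom_seq m) = m i.
Proof.
rewrite /cmonom_seq count_flatten -map_comp sumnE big_map.
under eq_bigr do rewrite /= count_nseq.
have [im|im] := boolP (i \in finsupp m).
  rewrite (bigD1_seq i) ?fset_uniq //= ?eqxx ?mul1n big1 ?addn0 // => j.
  by move/negPf; rewrite /= => ->.
rewrite big1_seq; first by apply/esym/fsfun_dflt.
by move=> j /= jm; case: eqP im => // <-; rewrite jm.
Qed.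

Definition words m : {fset {fmonom nat}} :=
  [fset FMonom s | s in permutations (cmonom_seq m)].

Lemma mem_words m w : (w \in words m) = (content w == m).
Proof.
apply/imfsetP/cmP => [[s /= sP ->] i|E].
  rewrite contentE -count_cmonom_seq.
  by move: sP; rewrite mem_permutations => /permP->.
exists (w : seq nat); last by rewrite fmK.
rewrite /= mem_permutations /perm_eq; apply/allP => i _ /=.
by rewrite count_cmonom_seq -contentE E.
Qed.

Definition csplits m : {fset {cmonom nat} * {cmonom nat}} :=
  [fset (content p.1, content p.2) | w in words m, p in splits w].

Fact mem_csplits m p : (p \in csplits m) = (mmul p.1 p.2 == m).
Proof.
have wordE n : content (FMonom (cmonom_seq n)) = n.
  by apply/eqP/cmP => i; rewrite contentE /= count_cmonom_seq.
apply/imfset2P/eqP => [[w wm [q qw ->]] /=|Em].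
  move: (wm : w \in words m) (qw : q \in splits w).
  by rewrite mem_words mem_splits => /eqP<- /eqP<-; rewrite contentM.
pose v := FMonom (cmonom_seq p.1); pose w := FMonom (cmonom_seq p.2).
have vwm : mmul v w \in words m by rewrite mem_words contentM !wordE Em.
exists (mmul v w); first exact: vwm.
have vws : (v, w) \in splits (mmul v w) by rewrite mem_splits.
exists (v, w); first exact: vws.
by rewrite /= !wordE; case: p {Em v w vwm vws}.
Qed.

HB.instance Definition _ :=
  MonomialDef_isLocallyFinite.Build {cmonom nat} mem_csplits.

End Words.

(* Q[[x_0, x_1, ...]] with noncommuting, respectively commuting, variables;
   the variables are indexed from 0. *)
Notation ncseries := (series {fmonom nat}).
Notation cseries := (series {cmonom nat}).

(* The morphism letting the variables commute: the coefficient of [m] collects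
   those of the finitely many words with content [m]. *)
Definition rho (f : ncseries) : cseries := fun m => \sum_(w <- words m) f w.

Fact rho_is_linear : linear rho.
Proof.
move=> a f g; apply/funext => m; rewrite /rho.
rewrite [RHS](_ : _ = a * \sum_(w <- words m) f w + \sum_(w <- words m) g w) //.
by rewrite mulr_sumr -big_split.
Qed.

Fact rho_is_monoid_morphism : monoid_morphism rho.
Proof.
split=> [|f g]; apply/funext => m; rewrite /rho.
  rewrite series1E; under eq_bigr do rewrite series1E.
  have c1 : content mone = mone by apply/eqP/cmP=> i; rewrite contentE fm1 cm1.
  have [->|ne] := eqVneq m mone.
    rewrite (bigD1_seq mone) ?mem_words ?c1 ?fset_uniq //= eqxx.
    by rewrite big1 ?addr0 // => w /negPf->.
  rewrite big1_seq // => w /=; rewrite mem_words => /eqP wm.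
  by case: eqP => // w1; move: ne; rewrite -wm w1 c1 eqxx.
rewrite seriesME.
under eq_bigr do rewrite seriesME.
pose F (t : {fmonom nat} * {fmonom nat}) : rat := f t.1 * g t.2.
pose T (p : {cmonom nat} * {cmonom nat}) :=
  [seq (v, w) | v <- words p.1, w <- words p.2].
have mem_T p t : (t \in T p) = ((content t.1, content t.2) == p).
  case: t p => [v w] [a b]; rewrite xpair_eqE /=.
  apply/allpairsPdep/andP => [[x [y [+ + [-> ->]]]]|[av bw]].
    by rewrite !mem_words.
  by exists v, w; rewrite !mem_words.
have uniq_T p : uniq (T p).
  by apply: allpairs_uniq; rewrite ?fset_uniq // => -[? ?] [? ?] _ _ [-> ->].
transitivity (\sum_(p <- splits m) \sum_(t <- T p) F t); last first.
  by apply: eq_bigr => p _; rewrite big_distrlr /= /T big_allpairs_dep.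
apply: (@eq_big_allpairs _ _ _ _ _ (words m) splits (fun w t => t)
  (splits m) T (fun p t => t) F).
- apply: allpairs_uniq_dep => [|? _|]; rewrite ?fset_uniq ?uniq_T //.
  move=> [v s] [w t] /allpairsPdep[v1 [s1 [_ vs E1]]].
  move=> /allpairsPdep[w1 [t1 [_ wt E2]]] /=.
  case: E1 => ? ?; case: E2 => ? ?; subst=> st; subst.
  by move: vs wt; rewrite !mem_splits => /eqP-> /eqP->.
- apply: allpairs_uniq_dep => [|? _|]; rewrite ?fset_uniq ?uniq_T //.
  move=> [v s] [w t] /allpairsPdep[v1 [s1 [_ vs E1]]].
  move=> /allpairsPdep[w1 [t1 [_ wt E2]]] /=.
  case: E1 => ? ?; case: E2 => ? ?; subst=> st; subst.
  by move: vs wt; rewrite !mem_T => /eqP-> /eqP->.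
- move=> t; apply/allpairsPdep/allpairsPdep => [[w [s [wm sw ->]]]|].
    exists (content s.1, content s.2), s; rewrite mem_T mem_splits /= -contentM.
    by move: sw wm; rewrite mem_splits mem_words => /eqP->.
  move=> [p [s [pm sp ->]]]; exists (mmul s.1 s.2), s.
  rewrite mem_splits mem_words contentM eqxx; split=> //.
  by move: sp pm; rewrite mem_T mem_splits => /eqP<-.
Qed.

HB.instance Definition _ :=
  GRing.isLinear.Build rat ncseries cseries _ rho rho_is_linear.
HB.instance Definition _ :=
  GRing.isMonoidMorphism.Build ncseries cseries rho rho_is_monoid_morphism.

Lemma rho_var i : rho (fun w => (w == fmu i)%:R) = fun m => (m == ucm i)%:R.
Proof.
apply/funext => m; rewrite /rho.
have cU : content (fmu i) = ucm i.
  by apply/eqP/cmP => j; rewrite contentE fmU /= addn0 cmU.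
have [->|ne] := eqVneq m (ucm i).
  rewrite (bigD1_seq (fmu i)) ?mem_words ?cU ?fset_uniq //= eqxx.
  by rewrite big1 ?addr0 // => w /negPf->.
rewrite big1_seq // => w /=; rewrite mem_words => /eqP wm.
by case: eqP => // wi; move: ne; rewrite -wm wi cU eqxx.
Qed.

(* Homogeneous of degree [n] and invariant under permutations of the
   variables: [m2] is the image of [m1] under [x_i |-> x_(s i)]. *)
Definition Sym (n : nat) (f : cseries) : Prop :=
  (forall m, f m != 0 -> mdeg m = n) /\
  (forall s : nat -> nat, bijective s ->
   forall m1 m2 : {cmonom nat}, (forall i, m2 (s i) = m1 i) -> f m2 = f m1).

Definition is_basis (R : pzRingType) (V : lmodType R) (I : finType)
    (W : V -> Prop) (b : I -> V) : Prop :=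
  [/\ forall i, W (b i),
      forall c : I -> R, \sum_i c i *: b i = 0 -> forall i, c i = 0 &
      forall v, W v -> exists c : I -> R, v = \sum_i c i *: b i].

Definition is_intpart (l : seq nat) := sorted geq l && (0%N \notin l).

Record intpart := IntPart { parts :> seq nat; _ : is_intpart parts }.

HB.instance Definition _ := [isSub for parts].
HB.instance Definition _ := [Countable of intpart by <:].

Fact is_intpart_join (l g : intpart) : is_intpart (sort geq (l ++ g)).
Proof.
case: l g => [l /= /andP[_ l0]] [g /= /andP[_ g0]].
rewrite /is_intpart mem_sort mem_cat negb_or l0 g0 !andbT.
by apply: sort_sorted => x y; exact: leq_total.
Qed.

(* lambda | gamma *)
Definition intpart_join (l g : intpart) : intpart :=
  IntPart (is_intpart_join l g).

Record intpartn n :=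
  IntPartN { intpart_of :> intpart; _ : sumn intpart_of == n }.

HB.instance Definition _ n := [isSub for @intpart_of n].
HB.instance Definition _ n := [Countable of intpartn n by <:].

Section IntPartNFinite.
Variable n : nat.

Definition intpartn_code (l : intpartn n) : n.-bseq 'I_n.+1 :=
  insub_bseq n [seq inord i | i <- l].

Definition intpartn_decode (t : n.-bseq 'I_n.+1) : option (intpartn n) :=
  obind insub (insub [seq val i | i <- t]).

Fact intpartn_codeK : pcancel intpartn_code intpartn_decode.
Proof.
move=> l; rewrite /intpartn_code /intpartn_decode.
have size_le (s : seq nat) : 0%N \notin s -> (size s <= sumn s)%N.
  elim: s => //= a s IHs; rewrite inE negb_or eq_sym -lt0n => /andP[a0 /IHs].
  by move=> le; rewrite -add1n leq_add.
have part_le (s : seq nat) i : i \in s -> (i <= sumn s)%N.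
  elim: s => //= a s IHs; rewrite inE => /orP[/eqP->|/IHs/leq_trans->//].
    exact: leq_addr.
  exact: leq_addl.
have /eqP ln := valP l; have /andP[_ l0] := valP (val l).
rewrite [X in insub X](_ : _ = val (val l)) ?valK /= ?valK //.
rewrite /insub_bseq val_insubd size_map.
rewrite (leq_trans (size_le _ l0)) ?ln //.
rewrite -map_comp -[RHS]map_id; apply/eq_in_map => i il /=.
by rewrite inordK // ltnS (leq_trans (part_le _ _ il)) ?ln.
Qed.

HB.instance Definition _ : isFinite (intpartn n) := PCanIsFinite intpartn_codeK.

End IntPartNFinite.

(* A set partition of [n] points is a [pi : {set {set 'I_n}}] such that
   [partition pi [set: 'I_n]]. *)

Definition refines n (sigma pi : {set {set 'I_n}}) : bool :=
  [forall B in sigma, exists C in pi, B \subset C].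

(* The closed form, only meaningful when [refines sigma pi]. *)
Definition moebius n (sigma pi : {set {set 'I_n}}) : rat :=
  \prod_(C in pi) let k := #|[set B in sigma | B \subset C]| in
    (-1) ^+ k.-1 * (k.-1)`!%:R.

Definition slash n m (pi : {set {set 'I_n}}) (sigma : {set {set 'I_m}}) :
    {set {set 'I_(n + m)}} :=
  [set [set lshift m i | i in B] | B : {set 'I_n} in pi] :|:
  [set [set rshift n i | i in B] | B : {set 'I_m} in sigma].

Lemma partition_slash n m (pi : {set {set 'I_n}}) (sigma : {set {set 'I_m}}) :
  partition pi [set: 'I_n] -> partition sigma [set: 'I_m] ->
  partition (slash pi sigma) [set: 'I_(n + m)].
Proof.
move=> /and3P[/eqP cp /trivIsetP tp zp] /and3P[/eqP cs /trivIsetP ts zs].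
have dlr (B : {set 'I_n}) (C : {set 'I_m}) :
    [disjoint [set lshift m i | i in B] & [set rshift n i | i in C]].
  apply/pred0P => k /=; apply/negP => /andP[/imsetP[i _ ->] /imsetP[j _ E]].
  by move/eqP: E; rewrite eq_lrshift.
apply/and3P; split.
- rewrite eqEsubset subsetT; apply/subsetP => k _; apply/bigcupP.
  case: (split_ordP k) => i ->.
    have /bigcupP[B Bp iB] : i \in cover pi by rewrite cp inE.
    exists [set lshift m i | i in B]; last exact: imset_f.
    by rewrite inE imset_f.
  have /bigcupP[B Bp iB] : i \in cover sigma by rewrite cs inE.
  exists [set rshift n i | i in B]; last exact: imset_f.
  by rewrite inE orbC imset_f.
- apply/trivIsetP => A B /setUP[]/imsetP[A' Ap ->] /setUP[]/imsetP[B' Bp ->].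
  + move=> ne; rewrite imset_disjoint; last exact: @lshift_inj.
    by apply: tp => //; apply: contraNneq ne => ->.
  + by move=> _; apply: dlr.
  + by move=> _; rewrite disjoint_sym; apply: dlr.
  + move=> ne; rewrite imset_disjoint; last exact: @rshift_inj.
    by apply: ts => //; apply: contraNneq ne => ->.
- apply/negP => /setUP[]/imsetP[B Bp /esym/eqP].
    by rewrite imset_eq0 => /eqP B0; rewrite B0 (negPf zp) in Bp.
  by rewrite imset_eq0 => /eqP B0; rewrite B0 (negPf zs) in Bp.
Qed.

(* Only a set partition for [n > 0]. *)
Definition one_block n : {set {set 'I_n}} := [set [set: 'I_n]].

Fixpoint blocks (l : seq nat) : {set {set 'I_(sumn l)}} :=
  if l is a :: l' then slash (one_block a) (blocks l') else set0.

Lemma partition_blocks (l : intpart) : partition (blocks l) [set: 'I_(sumn l)].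
Proof.
case: l => l /= /andP[_]; elim: l => [|a l IHl] /=.
  move=> _; apply/and3P; split; rewrite ?inE //.
    by rewrite /cover big_set0; apply/eqP/setP => -[].
  by apply/trivIsetP => A B; rewrite inE.
rewrite inE negb_or eq_sym => /andP[a0 /IHl]; apply: partition_slash.
apply/and3P; split; rewrite /one_block ?inE.
- by rewrite /cover big_set1.
- by apply/trivIsetP => A B; rewrite !inE => /eqP-> /eqP->; rewrite eqxx.
- apply/eqP => E; have := cardsT 'I_a; rewrite -E cards0 card_ord.
  by move=> a_eq0; rewrite -a_eq0 in a0.
Qed.

(* p_pi, x_pi and x_lambda are [powersum_nc], [extra_nc] and [extra]. *)
Definition powersum_nc n (pi : {set {set 'I_n}}) : ncseries := fun w =>
  ((size w == n) && [forall B in pi, forall j in B, forall k in B,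
     nth 0%N w (j : 'I_n) == nth 0%N w (k : 'I_n)])%:R.

Definition extra_nc n (pi : {set {set 'I_n}}) : ncseries :=
  \sum_(sigma | partition sigma [set: 'I_n] && refines sigma pi)
    moebius sigma pi *: powersum_nc sigma.

Definition extra (l : intpart) : cseries := rho (extra_nc (blocks l)).

(* Main.v *)
Require Import Defs.
From mathcomp Require Import all_boot all_order all_algebra.
From mathcomp Require Import finmap boolp functions.
From mathcomp.multinomials Require Import monalg.

(* The interval below a slash product is a product of intervals and both the
   Moebius function and the [p_pi] are multiplicative, so [x_pi] turns slash
   products into products; after applying [rho] these commute, whence
   [x_lambda] is the product of the [x_a] over the parts [a] of [lambda].

   Letting the variables commute turns [p_sigma] into the product of the power
   sums [p_|B|] over the blocks [B] of [sigma], so that [x_n] is [p_n] plus a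
   combination of products of power sums of smaller degree. By induction every
   [p_lambda] is in the span of the [x_mu], of the same degree. The [p_lambda]
   are triangular with respect to monomials ordered by number of variables, hence
   a basis of [Sym n]; the [x_lambda] span it and are as many, hence are a basis
   too. *)

Set Implicit Arguments.
Unset Strict Implicit.
Unset Printing Implicit Defensive.

Import Order.TTheory GRing.Theory Num.Theory.
Local Open Scope ring_scope.

(** * Slash products of set partitions *)

Lemma imset_inj_sub (aT rT : finType) (f : aT -> rT) (A B : {set aT}) :
  injective f -> ([set f x | x in A] \subset [set f x | x in B]) = (A \subset B).
Proof.
move=> injf; apply/idP/idP => [/subsetP sAB|/imsetS->//].
by apply/subsetP => x xA; rewrite -(mem_imset _ _ injf) sAB ?imset_f.
Qed.

Lemma imset_preimset (aT rT : finType) (f : aT -> rT) (B : {set aT}) (D : {set rT}) :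
  D \subset [set f x | x in B] -> [set f x | x in f @^-1: D] = D.
Proof.
move=> /subsetP sD; apply/setP => y; apply/imsetP/idP => [[x + ->]|yD].
  by rewrite inE.
by have /imsetP[x _ yx] := sD _ yD; exists x; rewrite // inE -yx.
Qed.

Lemma partition_set0 (T : finType) (D : {set T}) (P : {set {set T}}) :
  partition P D -> set0 \notin P.
Proof. by case/and3P. Qed.

Section Slash.
Variables n m : nat.
Implicit Types (pi alpha : {set {set 'I_n}}) (sigma beta : {set {set 'I_m}}).
Implicit Types (B : {set 'I_n}) (C : {set 'I_m}) (gamma : {set {set 'I_(n + m)}}).

Let L B : {set 'I_(n + m)} := [set lshift m i | i in B].
Let R C : {set 'I_(n + m)} := [set rshift n i | i in C].

Lemma lshift_imset_inj : injective (fun B => [set lshift m i | i in B]).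
Proof. exact/imset_inj/lshift_inj. Qed.

Lemma rshift_imset_inj : injective (fun C => [set rshift n i | i in C]).
Proof. exact/imset_inj/rshift_inj. Qed.

(** The two shifts have disjoint ranges, so blocks from the two sides can only be compared when one
    is empty. This is why properness ([set0] not a block) is assumed repeatedly below. *)
Lemma rshift_imset_sub_lshift B C :
  (R C \subset L B) = (C == set0).
Proof.
apply/idP/eqP => [|->]; last by rewrite /R imset0 sub0set.
case: (set_0Vmem C) => // -[j jC] /subsetP/(_ _ (imset_f _ jC))/imsetP[i _ /eqP].
by rewrite eq_rlshift.
Qed.

Lemma lshift_imset_sub_rshift B C :
  (L B \subset R C) = (B == set0).
Proof.
apply/idP/eqP => [|->]; last by rewrite /L imset0 sub0set.
case: (set_0Vmem B) => // -[j jC] /subsetP/(_ _ (imset_f _ jC))/imsetP[i _ /eqP].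
by rewrite eq_lrshift.
Qed.

Lemma mem_slash_lshift pi sigma B : set0 \notin sigma ->
  (L B \in slash pi sigma) = (B \in pi).
Proof.
move=> s0; rewrite inE mem_imset; last exact: lshift_imset_inj.
apply/orb_idr => /imsetP[C Cs E].
have := rshift_imset_sub_lshift B C; rewrite /R -E subxx => /esym/eqP C0.
by rewrite -C0 Cs in s0.
Qed.

Lemma mem_slash_rshift pi sigma C : set0 \notin pi ->
  (R C \in slash pi sigma) = (C \in sigma).
Proof.
move=> s0; rewrite inE orbC mem_imset; last exact: rshift_imset_inj.
apply/orb_idr => /imsetP[B Bs E].
have := lshift_imset_sub_rshift B C; rewrite /L -E subxx => /esym/eqP B0.
by rewrite -B0 Bs in s0.
Qed.

(** Each coefficient of the product receives at most one term, since the lengths [n] and [m] fix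
    where the word is cut; the shifted blocks then constrain prefix and suffix separately. *)
Lemma powersum_nc_slash alpha beta :
  powersum_nc (slash alpha beta) = powersum_nc alpha * powersum_nc beta.
Proof.
apply/funext => w; rewrite seriesME.
have [sw|sw] := eqVneq (size w) (n + m)%N; last first.
  rewrite /powersum_nc (negPf sw) big1_seq // => -[u v] /=.
  rewrite mem_splits => /eqP /= uv; case: eqP => [su|]; rewrite ?mul0r //=.
  case: (size v =P m) => [sv|]; rewrite ?mulr0 //=.
  by rewrite -uv fmM size_cat su sv eqxx in sw.
(* The only factorization of [w] that can contribute. *)
pose p0 := (FMonom (take n w), FMonom (drop n w)).
have s1 : size (take n w) = n by rewrite size_takel // sw leq_addr.
have s2 : size (drop n w) = m by rewrite size_drop sw addKn.
rewrite (bigD1_seq p0) ?fset_uniq //=; last first.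
  by rewrite mem_splits; apply/eqP/val_inj; rewrite /= fmM /= cat_take_drop.
rewrite [X in _ + X]big1_seq ?addr0; last first.
  move=> [u v] /= /andP[ne]; rewrite mem_splits => /eqP /= uv.
  rewrite /powersum_nc; case: eqP => [su|]; rewrite ?mul0r //=.
  case/negP: ne; rewrite xpair_eqE -uv fmM.
  by rewrite take_size_cat // drop_size_cat // !fmK !eqxx.
rewrite /powersum_nc /= s1 s2 sw !eqxx /= -natrM mulnb; congr (_%:R : rat).
congr (nat_of_bool _); apply/idP/andP => [/forall_inP H|[/forall_inP Ha /forall_inP Hb]].
  split; apply/forall_inP => B Bin; apply/forall_inP => j jB.
    apply/forall_inP => k kB; rewrite !nth_take //.
    have /H/forall_inP/(_ _ (imset_f _ jB))/forall_inP/(_ _ (imset_f _ kB)) :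
      L B \in slash alpha beta by rewrite inE imset_f.
    by [].
  apply/forall_inP => k kB; rewrite !nth_drop.
  have /H/forall_inP/(_ _ (imset_f _ jB))/forall_inP/(_ _ (imset_f _ kB)) :
    R B \in slash alpha beta by rewrite inE orbC imset_f.
  by [].
apply/forall_inP => D /setUP[]/imsetP[B Bin ->].
  apply/forall_inP => _ /imsetP[j jB ->]; apply/forall_inP => _ /imsetP[k kB ->].
  by have /forall_inP/(_ j jB)/forall_inP/(_ k kB) := Ha B Bin; rewrite !nth_take.
apply/forall_inP => _ /imsetP[j jB ->]; apply/forall_inP => _ /imsetP[k kB ->].
by have /forall_inP/(_ j jB)/forall_inP/(_ k kB) := Hb B Bin; rewrite !nth_drop.
Qed.

(** The product over blocks splits by side, and the blocks contained in a shifted block are the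
    shifts of those contained in the original. An empty block would be counted on both sides. *)
Lemma moebius_slash alpha beta pi sigma :
    set0 \notin alpha -> set0 \notin beta -> set0 \notin pi ->
  moebius (slash alpha beta) (slash pi sigma) =
  moebius alpha pi * moebius beta sigma.
Proof.
move=> a0 b0 p0; rewrite /moebius.
rewrite (eq_bigl [in [predU L @: pi & R @: sigma]]) => [|D]; last first.
  by rewrite /= !inE.
rewrite bigU /=; last first.
  rewrite -setI_eq0; apply/eqP/setP => D; rewrite !inE.
  apply/negP => /andP[/imsetP[B Bp ->] /imsetP[C Cs E]].
  rewrite -/(L B) -/(R C) in E.
  have := lshift_imset_sub_rshift B C; rewrite E subxx => /esym/eqP B0.
  by rewrite -B0 Bp in p0.
rewrite !big_imset /=; try by move=> ? ? _ _;
  do [exact: lshift_imset_inj|exact: rshift_imset_inj].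
congr (_ * _); apply: eq_bigr => B _.
  suff -> : [set D in slash alpha beta | D \subset L B] =
    [set L C | C in [set C in alpha | C \subset B]].
    by rewrite card_imset //; exact: lshift_imset_inj.
  apply/setP => D; apply/setIdP/imsetP => [[/setUP[]/imsetP[C Ci ->]]|[C + ->]].
  - rewrite imset_inj_sub => [CB|]; last exact: lshift_inj.
    by exists C; rewrite // inE Ci.
  - by rewrite rshift_imset_sub_lshift => /eqP C0; rewrite -C0 Ci in b0.
  - rewrite inE => /andP[Ci CB]; split; last exact: imsetS.
    by rewrite mem_slash_lshift.
suff -> : [set D in slash alpha beta | D \subset R B] =
  [set R C | C in [set C in beta | C \subset B]].
  by rewrite card_imset //; exact: rshift_imset_inj.
apply/setP => D; apply/setIdP/imsetP => [[/setUP[]/imsetP[C Ci ->]]|[C + ->]].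
- by rewrite lshift_imset_sub_rshift => /eqP C0; rewrite -C0 Ci in a0.
- by rewrite imset_inj_sub => [CB|]; last exact: rshift_inj; exists C; rewrite // inE Ci.
- rewrite inE => /andP[Ci CB]; split; last exact: imsetS.
  by rewrite mem_slash_rshift.
Qed.

Lemma slash_inj_lshift alpha beta : set0 \notin beta ->
  [set B | L B \in slash alpha beta] = alpha.
Proof. by move=> b0; apply/setP => B; rewrite inE mem_slash_lshift. Qed.

Lemma slash_inj_rshift alpha beta : set0 \notin alpha ->
  [set C | R C \in slash alpha beta] = beta.
Proof. by move=> b0; apply/setP => B; rewrite inE mem_slash_rshift. Qed.

Lemma refines_slash alpha beta pi sigma :
    set0 \notin alpha -> set0 \notin beta ->
  refines (slash alpha beta) (slash pi sigma) =
  refines alpha pi && refines beta sigma.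
Proof.
move=> a0 b0; apply/forall_inP/andP => [H|[/forall_inP Ha /forall_inP Hb]].
  split; apply/forall_inP => B Bin; apply/exists_inP.
    have /H/exists_inP[D /setUP[]/imsetP[C Ci ->]] : L B \in slash alpha beta.
    - by rewrite inE imset_f.
    - by rewrite imset_inj_sub => [CB|]; [exists C|exact: lshift_inj].
    - by rewrite lshift_imset_sub_rshift => /eqP B0; rewrite -B0 Bin in a0.
  have /H/exists_inP[D /setUP[]/imsetP[C Ci ->]] : R B \in slash alpha beta.
  - by rewrite inE orbC imset_f.
  - by rewrite rshift_imset_sub_lshift => /eqP B0; rewrite -B0 Bin in b0.
  - by rewrite imset_inj_sub => [CB|]; [exists C|exact: rshift_inj].
move=> D /setUP[]/imsetP[B Bi ->]; apply/exists_inP.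
  have /exists_inP[C Ci sBC] := Ha _ Bi.
  by exists (L C); [rewrite inE imset_f|rewrite imsetS].
have /exists_inP[C Ci sBC] := Hb _ Bi.
by exists (R C); [rewrite inE orbC imset_f|rewrite imsetS].
Qed.

(** A block of [gamma] lies inside a block of the slash product, hence on one side, so it is the
    shift of its own preimage. *)
Lemma slash_restrictK gamma pi sigma : refines gamma (slash pi sigma) ->
  slash [set B | L B \in gamma] [set C | R C \in gamma] = gamma.
Proof.
move=> /forall_inP ref; apply/setP => D; apply/setUP/idP.
  by case=> /imsetP[B + ->]; rewrite inE.
move=> Dg; have /exists_inP[E /setUP[]/imsetP[B _ ->] /imset_preimset DE] := ref _ Dg.
  by left; apply/imsetP; exists (lshift m @^-1: D); rewrite // inE /L DE.
by right; apply/imsetP; exists (@rshift n m @^-1: D); rewrite // inE /R DE.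
Qed.

Lemma partition_slash_inv alpha beta :
    partition (slash alpha beta) [set: 'I_(n + m)] ->
  partition alpha [set: 'I_n] /\ partition beta [set: 'I_m].
Proof.
move=> /and3P[/eqP cg /trivIsetP tg g0].
have a0 : set0 \notin alpha.
  by apply: contra g0 => a0; rewrite inE -(imset0 (lshift m)) imset_f.
have b0 : set0 \notin beta.
  by apply: contra g0 => b0; rewrite inE orbC -(imset0 (@rshift n m)) imset_f.
split; apply/and3P; split=> //.
- rewrite eqEsubset subsetT; apply/subsetP => i _; apply/bigcupP.
  have /bigcupP[D /setUP[]/imsetP[B Bi ->]] :
    lshift m i \in cover (slash alpha beta) by rewrite cg inE.
    by rewrite mem_imset => [iB|]; [exists B|exact: lshift_inj].
  by case/imsetP => j _ /eqP; rewrite eq_lrshift.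
- apply/trivIsetP => A B Aa Ba AB.
  rewrite -(imset_disjoint (f := lshift m)); last exact: lshift_inj.
  rewrite tg ?inE ?imset_f //.
  by apply: contraNneq AB => /lshift_imset_inj->.
- rewrite eqEsubset subsetT; apply/subsetP => i _; apply/bigcupP.
  have /bigcupP[D /setUP[]/imsetP[B Bi ->]] :
    rshift n i \in cover (slash alpha beta) by rewrite cg inE.
    by case/imsetP => j _ /eqP; rewrite eq_rlshift.
  by rewrite mem_imset => [iB|]; [exists B|exact: rshift_inj].
- apply/trivIsetP => A B Aa Ba AB.
  rewrite -(imset_disjoint (f := @rshift n m)); last exact: rshift_inj.
  rewrite tg ?inE ?imset_f ?orbT //.
  by apply: contraNneq AB => /rshift_imset_inj->.
Qed.

(** The map sending [(alpha, beta)] to their slash product is a bijection from pairs of refinements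
    of [pi] and [sigma] to refinements of the slash product; the summands match by
    multiplicativity. *)
Lemma extra_nc_slash pi sigma :
    partition pi [set: 'I_n] -> partition sigma [set: 'I_m] ->
  extra_nc (slash pi sigma) = extra_nc pi * extra_nc sigma.
Proof.
move=> Pp Ps; rewrite /extra_nc mulr_suml.
under [RHS]eq_bigr do rewrite mulr_sumr.
rewrite pair_big /=.
(* The inverse map restricts a partition to each side. *)
rewrite (reindex_onto (fun p => slash p.1 p.2)
  (fun g => ([set B | L B \in g], [set C | R C \in g]))) /=; last first.
  by move=> g /andP[_ /slash_restrictK].
apply: eq_big => [[alpha beta]|[alpha beta]] /=.
  apply/andP/andP => [[/andP[/[dup]/partition_slash_inv[Pa Pb] _]]|].
    rewrite refines_slash ?(partition_set0 Pa) ?(partition_set0 Pb) // Pa Pb.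
    by case/andP.
  move=> [/andP[Pa ra] /andP[Pb rb]].
  have a0 := partition_set0 Pa; have b0 := partition_set0 Pb.
  by rewrite refines_slash // partition_slash // ra rb slash_inj_lshift ?slash_inj_rshift.
move=> /andP[/andP[/partition_slash_inv[Pa Pb] _] _].
rewrite moebius_slash ?(partition_set0 Pa) ?(partition_set0 Pb) ?(partition_set0 Pp) //.
by rewrite powersum_nc_slash -scalerAl -scalerAr scalerA.
Qed.
End Slash.

(** * Factorization of [x_lambda] over its parts *)

Definition extra_block (n : nat) : series {cmonom nat} :=
  rho (extra_nc (one_block n)).

Lemma partition_one_block n : (0 < n)%N -> partition (one_block n) [set: 'I_n].
Proof.
move=> n0; apply/and3P; split; rewrite /one_block ?inE.
- by rewrite /cover big_set1.
- by apply/trivIsetP => A B; rewrite !inE => /eqP-> /eqP->; rewrite eqxx.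
- by apply: contraTneq n0 => E; rewrite -[n]card_ord -cardsT -E cards0.
Qed.

(** On zero points the empty family is the only set partition, and its power sum is supported on the
    empty word. *)
Lemma extra_nc_set0 : extra_nc (set0 : {set {set 'I_0}}) = 1.
Proof.
have set0E (sigma : {set {set 'I_0}}) : set0 \notin sigma -> sigma = set0.
  move=> s0; apply/setP => B; rewrite [RHS]inE; apply: contraNF s0.
  by rewrite (_ : B = set0) //; apply/setP => -[].
have P0 : partition set0 [set: 'I_0].
  have ip0 : is_intpart [::] by [].
  exact: (partition_blocks (IntPart ip0)).
rewrite /extra_nc (big_pred1 set0) => [|sigma]; last first.
  apply/andP/eqP => [[/and3P[_ _ /set0E->]]|->] //; split=> //.
  by apply/forall_inP => B; rewrite inE.
rewrite /moebius big_set0 scale1r; apply/funext => w.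
rewrite series1E /powersum_nc; congr ((nat_of_bool _)%:R).
transitivity (size w == 0%N).
  by apply/andb_idr => _; apply/forall_inP => B; rewrite inE.
by apply/nilP/eqP => [w0|->]; [apply/val_inj; rewrite /= w0 fm1|rewrite fm1].
Qed.

Lemma extraE (l : intpart) : extra l = \prod_(a <- l) extra_block a.
Proof.
rewrite /extra; case: l => /= l; elim: l => [_|a l IHl] /=.
  by rewrite big_nil extra_nc_set0 rmorph1.
case/andP=> /= lsorted; rewrite inE negb_or eq_sym -lt0n => /andP[a0 l0].
have lP : is_intpart l by rewrite /is_intpart (path_sorted lsorted).
rewrite extra_nc_slash ?partition_one_block //; last exact: partition_blocks (IntPart lP).
by rewrite rmorphM /= IHl // big_cons.
Qed.

(** Both sides are products over the same multiset of parts, so the sorting in [intpart_join] is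
    harmless in a commutative ring. *)
Lemma extra_join (l g : intpart) : extra (intpart_join l g) = extra l * extra g.
Proof. by rewrite !extraE /= (perm_big (l ++ g)) ?big_cat //= perm_sort. Qed.

(** * Monomials, power sums and truncation to finitely many variables *)

Local Notation cseries := (series {cmonom nat}).

(* [x_i ^ k] *)
Definition xpow (k i : nat) : {cmonom nat} := content (FMonom (nseq k i)).

Lemma xpowE k i j : xpow k i j = (k * (i == j))%N.
Proof. by rewrite /xpow contentE /= count_nseq mulnC. Qed.

Definition monomial (m : {cmonom nat}) : cseries := fun m' => (m' == m)%:R.

Lemma monomialE m m' : monomial m m' = (m' == m)%:R.
Proof. by []. Qed.

Lemma seriesM_neq0 (M : lfMonomType) (f g : series M) m : (f * g) m != 0 ->
  exists p, [/\ mmul p.1 p.2 = m, f p.1 != 0 & g p.2 != 0].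
Proof.
rewrite seriesME => ne0.
suff /hasP[p] : has (fun p => f p.1 * g p.2 != 0) (splits m).
  by rewrite mem_splits mulf_eq0 negb_or => /eqP pm /andP[f0 g0]; exists p.
apply: contraNT ne0 => /hasPn H; apply/eqP; apply: big1_seq => p /= ps.
by apply/eqP; rewrite -[_ == _]negbK; apply: H.
Qed.

Lemma monomial1 : monomial mone = 1.
Proof. by []. Qed.

Lemma monomialM m1 m2 : monomial m1 * monomial m2 = monomial (mmul m1 m2).
Proof.
apply/funext => m; rewrite seriesME monomialE.
have [->|ne] := eqVneq m (mmul m1 m2).
  rewrite (bigD1_seq (m1, m2)) ?mem_splits ?fset_uniq //= !monomialE !eqxx.
  rewrite mul1r big1 ?addr0 // => -[p q]; rewrite xpair_eqE negb_and !monomialE /=.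
  by case/orP => /negPf->; rewrite ?mul0r ?mulr0.
rewrite big1_seq // => -[p q] /=; rewrite mem_splits !monomialE /= => /eqP E.
have [pE|_] := eqVneq p m1; last by rewrite mul0r.
have [qE|_] := eqVneq q m2; last by rewrite mulr0.
by rewrite -E pE qE eqxx in ne.
Qed.

Lemma monomial_prod (I : Type) (r : seq I) (P : pred I) (F : I -> {cmonom nat}) :
  \prod_(i <- r | P i) monomial (F i) = monomial (\big[mmul/mone]_(i <- r | P i) F i).
Proof. by apply/esym/(big_morph monomial _ monomial1) => x y; rewrite monomialM. Qed.

Lemma cm_prod (I : Type) (r : seq I) (P : pred I) (F : I -> {cmonom nat}) j :
  (\big[mmul/mone]_(i <- r | P i) F i) j = (\sum_(i <- r | P i) F i j)%N.
Proof.
by apply: (big_morph (fun m : {cmonom nat} => m j)) => [x y|]; rewrite ?cmM ?cm1.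
Qed.

Lemma series_sumE (M : monomType) (I : Type) (r : seq I) (P : pred I)
    (F : I -> series M) m :
  (\sum_(i <- r | P i) F i) m = \sum_(i <- r | P i) F i m.
Proof. by apply: (big_morph (fun f : series M => f m)). Qed.

(* The power sum [p_k] if [k > 0]; [powsum 0] is [1]. *)
Definition powsum (k : nat) : cseries := fun m => (`[< exists i, m = xpow k i >])%:R.

Definition below N (m : {cmonom nat}) := forall i, (N <= i)%N -> m i = 0%N.

(* [f] and [g] agree after setting [x_i = 0] for all [i >= N]. *)
Definition agree N (f g : cseries) := forall m, below N m -> f m = g m.

(** Every factor of a monomial in the first [N] variables involves only those variables. *)
Lemma agreeM N f1 g1 f2 g2 : agree N f1 g1 -> agree N f2 g2 ->
  agree N (f1 * f2) (g1 * g2).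
Proof.
move=> a1 a2 m mN; rewrite !seriesME; apply: eq_big_seq => -[p q].
rewrite mem_splits => /eqP /= E; rewrite a1 ?a2 // => i /mN /eqP.
  by rewrite -E cmM addn_eq0 => /andP[_ /eqP].
by rewrite -E cmM addn_eq0 => /andP[/eqP].
Qed.

Lemma agree_prod N (I : Type) (r : seq I) (P : pred I) (F G : I -> cseries) :
  (forall i, P i -> agree N (F i) (G i)) ->
  agree N (\prod_(i <- r | P i) F i) (\prod_(i <- r | P i) G i).
Proof.
by move=> FG; apply: (big_ind2 (agree N)) => // *; exact: agreeM.
Qed.

(** Truncation turns the infinite power sum into a finite sum, to which distributivity applies. For
    [k > 0] the monomials [xpow k i] are distinct, so none is counted twice. *)
Lemma agree_powsum N k : (0 < k)%N ->
  agree N (powsum k) (\sum_(i < N) monomial (xpow k i)).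
Proof.
move=> k0 m mN; rewrite series_sumE /powsum; case: asboolP => [[i mE]|nE].
  have iN : (i < N)%N.
    rewrite ltnNge; apply/negP => /mN/eqP.
    by rewrite mE xpowE eqxx muln1 -leqn0 leqNgt k0.
  rewrite (bigD1 (Ordinal iN)) //= monomialE mE eqxx big1 ?addr0 // => j.
  rewrite monomialE -val_eqE /= => /negPf ji; case: eqP => //.
  move/(congr1 (fun m : {cmonom nat} => m i)).
  by rewrite !xpowE eqxx ji muln1 muln0 => k00; rewrite k00 in k0.
rewrite big1 // => i _; rewrite monomialE; case: eqP => // mE.
by case: nE; exists i.
Qed.

Lemma exists_below m : exists N, below N.+1 m.
Proof.
exists (\max_(i <- finsupp m) i)%N => i Ni; apply/eqP; rewrite cmE_eq0.
by apply: contraTN Ni => im; rewrite -leqNgt; apply: leq_bigmax_seq.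
Qed.

(** * The commutative image of [p_sigma] *)

Section RhoPowersum.
Variables (n : nat) (sigma : {set {set 'I_n}}).
Hypothesis Psigma : partition sigma [set: 'I_n].
Variable N : nat.
Implicit Types h : {ffun {set 'I_n} -> 'I_N.+1}.

Let pblock_in i : pblock sigma i \in sigma.
Proof. by rewrite pblock_mem // (cover_partition Psigma) inE. Qed.

Let pblockE B i : B \in sigma -> i \in B -> pblock sigma i = B.
Proof. by move=> Bs iB; apply: def_pblock => //; case/and3P: Psigma. Qed.

Let nonempty B : B \in sigma -> B != set0.
Proof. by move=> Bs; apply: contraTneq Bs => ->; case/and3P: Psigma. Qed.

(** The word constant on the blocks of [sigma], with letters given by a colouring [h] of the blocks.
    As [h] is defined on all subsets, only colourings equal to [ord0] off [sigma] are used to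
    parametrize words. *)
Definition block_word h : {fmonom nat} :=
  FMonom [seq val (h (pblock sigma i)) | i <- enum 'I_n].

Lemma nth_block_word h (i : 'I_n) : nth 0%N (block_word h) i = h (pblock sigma i).
Proof.
by rewrite /= (nth_map i) ?size_enum_ord ?nth_ord_enum.
Qed.

(** Occurrences of a letter are counted block by block. *)
Lemma content_block_word h :
  content (block_word h) = \big[mmul/mone]_(B in sigma) xpow #|B| (h B).
Proof.
apply/eqP/cmP => j; rewrite contentE cm_prod /= count_map.
rewrite -sum1_count big_enum_cond /=.
rewrite big_mkcond (eq_bigl [in [set: 'I_n]]) => [|i]; last by rewrite /= !inE.
rewrite -(cover_partition Psigma) /= big_trivIset; last by case/and3P: Psigma.
apply: eq_bigr => B Bs; rewrite xpowE -sum1_card big_distrl /=.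
by apply: eq_bigr => i iB; rewrite (pblockE Bs iB) mul1n; case: (_ == j).
Qed.

Definition block_const (w : {fmonom nat}) :=
  (size w == n) && [forall B in sigma, forall j in B, forall k in B,
     nth 0%N w (j : 'I_n) == nth 0%N w (k : 'I_n)].

Lemma block_const_word h : block_const (block_word h).
Proof.
rewrite /block_const size_map size_enum_ord eqxx /=.
apply/forall_inP => B Bs; apply/forall_inP => j jB; apply/forall_inP => k kB.
by rewrite !nth_block_word (pblockE Bs jB) (pblockE Bs kB).
Qed.

Lemma block_word_inj :
  {in pffun_on ord0 (mem sigma) predT &, injective block_word}.
Proof.
move=> h g /pffun_onP[hs _] /pffun_onP[gs _] E; apply/ffunP => B.
have [Bs|nBs] := boolP (B \in sigma); last first.
  have out (f : {ffun {set 'I_n} -> 'I_N.+1}) :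
      ord0.-support f \subset sigma -> f B = ord0.
    by move=> fs; apply/eqP; apply: contraNT nBs => nB; apply: (subsetP fs).
  by rewrite !out.
have /set0Pn[i iB] := nonempty Bs.
apply/val_inj; move: (nth_block_word h i); rewrite E nth_block_word.
by rewrite (pblockE Bs iB) => /esym.
Qed.

Lemma block_wordP w : below N.+1 (content w) -> block_const w ->
  exists2 h, h \in pffun_on ord0 (mem sigma) predT & w = block_word h.
Proof.
move=> wN /andP[/eqP sw /forall_inP cw].
(* A block is coloured by the letter at any of its points; off [sigma] the value must be [ord0] for
   membership in [pffun_on]. *)
pose h : {ffun {set 'I_n} -> 'I_N.+1} := [ffun B =>
  if B \in sigma then (if [pick i in B] is Some i then inord (nth 0%N w i) else ord0)
  else ord0].
exists h.
  apply/pffun_onP; split=> //; apply/subsetP => B; rewrite inE ffunE.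
  by case: ifP => //; rewrite eqxx.
have sb : size (block_word h) = n by rewrite size_map size_enum_ord.
apply/val_inj/(@eq_from_nth _ 0%N) => /=; rewrite ?sw //.
move=> k kn; rewrite -[k]/(val (Ordinal kn)) (nth_block_word h (Ordinal kn)).
set i := Ordinal kn; rewrite ffunE pblock_in; case: pickP => [j jB|/(_ i)]; last first.
  by rewrite mem_pblock (cover_partition Psigma) inE.
have iB : i \in pblock sigma i by rewrite mem_pblock (cover_partition Psigma) inE.
have /forall_inP/(_ i iB)/forall_inP/(_ j jB)/eqP-> := cw _ (pblock_in i).
(* The letter occurs in [w], so it is at most [N] and [inord] does not alter it. *)
rewrite inordK // ltnNge; apply/negP => /wN/eqP; apply/negP.
by rewrite contentE -lt0n -has_count has_pred1 mem_nth ?sw.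
Qed.
End RhoPowersum.

(** At a monomial [m], the left side counts the words of content [m] that are constant on blocks.
    The right side, truncated to the variables of [m] and expanded, counts colourings of the blocks;
    [block_word] matches the two. *)
Lemma rho_powersum_nc n (sigma : {set {set 'I_n}}) : partition sigma [set: 'I_n] ->
  rho (powersum_nc sigma) = \prod_(B in sigma) powsum #|B|.
Proof.
move=> Ps; apply/funext => m; have [N mN] := exists_below m.
rewrite (@agree_prod N.+1 _ _ _ _
  (fun B : {set 'I_n} => \sum_(i < N.+1) monomial (xpow #|B| i))) //; last first.
  move=> B Bs; apply: agree_powsum; rewrite card_gt0.
  by apply: contraTneq Bs => ->; case/and3P: Ps.
rewrite (big_distr_big ord0) series_sumE.
under eq_bigr do rewrite monomial_prod monomialE -content_block_word // eq_sym.
rewrite /rho /powersum_nc.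
(* Both sides become sums of ones over lists, to be compared up to permutation. *)
have sumb (I : Type) (r : seq I) (P Q : pred I) :
    \sum_(i <- r | P i) (Q i)%:R = \sum_(i <- r | P i && Q i) (1 : rat).
  by rewrite big_mkcondr; apply: eq_bigr => i _; case: (Q i).
rewrite !sumb -big_enum_cond.
have := mem_enum (mem (pffun_on (@ord0 N) (mem sigma) predT)).
have := enum_uniq (mem (pffun_on (@ord0 N) (mem sigma) predT)).
move: (enum _) => E uE inE'.
rewrite -[RHS]big_filter -[RHS](big_map (@block_word n sigma N) predT (fun=> 1)).
rewrite -[LHS]big_filter; apply: perm_big; apply: uniq_perm.
- by rewrite filter_uniq // fset_uniq.
- rewrite map_inj_in_uniq ?filter_uniq // => h g.
  rewrite !mem_filter !inE' => /andP[_ +] /andP[_ +].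
  exact: block_word_inj.
move=> w; rewrite mem_filter; apply/andP/mapP => [[cw]|[h]].
  rewrite mem_words => /eqP wm; have [|h hP wE] := @block_wordP _ _ Ps N w _ cw.
    by rewrite wm; exact: mN.
  by exists h; rewrite // mem_filter inE' hP -wE wm eqxx.
rewrite mem_filter => /andP[hm _] ->; split; first exact: block_const_word.
by rewrite mem_words.
Qed.

(** * Expansion of [x_n] in power sums *)

Lemma moebius_refl_one_block n : (0 < n)%N -> moebius (one_block n) (one_block n) = 1.
Proof.
move=> n0; rewrite /moebius big_set1 (_ : [set _ in _ | _] = one_block n).
  by rewrite cards1 expr0 mul1r.
by apply/setP => B; rewrite !inE subsetT andbT.
Qed.

Lemma refines_one_block n (sigma : {set {set 'I_n}}) : refines sigma (one_block n).
Proof.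
apply/forall_inP => B _; apply/exists_inP; exists [set: 'I_n]; first by rewrite inE.
exact: subsetT.
Qed.

(** A block of full size would be the whole set and leave room for no other nonempty block. *)
Lemma card_block_lt n (sigma : {set {set 'I_n}}) B :
    partition sigma [set: 'I_n] -> sigma != one_block n -> B \in sigma ->
  (#|B| < n)%N.
Proof.
move=> /and3P[_ /trivIsetP ts s0] ne Bs; rewrite -[X in (_ < X)%N]card_ord -cardsT.
apply: proper_card; rewrite properT; apply: contraNneq ne => BT; apply/eqP/setP => C.
rewrite inE; apply/idP/eqP => [Cs|->]; last by rewrite -BT.
apply/eqP; apply: contraNT s0 => CT.
have := ts _ _ Cs Bs; rewrite BT => /(_ CT).
by rewrite -setI_eq0 setIT => /eqP <-.
Qed.

(** The one-block partition is the top of the lattice, so the sum runs over all set partitions, and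
    the top term has coefficient 1. *)
Lemma extra_blockE n : (0 < n)%N -> extra_block n = powsum n +
  \sum_(sigma | partition sigma [set: 'I_n] && (sigma != one_block n))
    moebius sigma (one_block n) *: \prod_(B in sigma) powsum #|B|.
Proof.
move=> n0; rewrite /extra_block /extra_nc linear_sum /=.
rewrite (bigD1 (one_block n)) /=; last first.
  by rewrite partition_one_block // refines_one_block.
rewrite moebius_refl_one_block // scale1r rho_powersum_nc ?partition_one_block //.
rewrite big_set1 cardsT card_ord; congr (_ + _).
apply: eq_big => [sigma|sigma /andP[/andP[Ps _] _]].
  by rewrite refines_one_block andbT.
by rewrite linearZ /= rho_powersum_nc.
Qed.

(** * The span of the [x_lambda] in each degree *)

Definition span_extra n (f : cseries) :=
  exists c : intpartn n -> rat, f = \sum_l c l *: extra l.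

Lemma span_extra_lin n a f g :
  span_extra n f -> span_extra n g -> span_extra n (a *: f + g).
Proof.
move=> [c ->] [d ->]; exists (fun l => a * c l + d l).
rewrite scaler_sumr -big_split; apply: eq_bigr => l _.
by rewrite scalerA scalerDl.
Qed.

Lemma span_extra0 n : span_extra n 0.
Proof. by exists (fun=> 0); rewrite big1 // => l _; rewrite scale0r. Qed.

Lemma span_extra_sum n (I : Type) (r : seq I) (P : pred I) (c : I -> rat)
    (F : I -> cseries) : (forall i, P i -> span_extra n (F i)) ->
  span_extra n (\sum_(i <- r | P i) c i *: F i).
Proof.
move=> PF; apply: big_rec => [|i f /PF Fi sf]; first exact: span_extra0.
exact: span_extra_lin.
Qed.

Lemma span_extra_mem n (l : intpart) : sumn l = n -> span_extra n (extra l).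
Proof.
move/eqP => ln; exists (fun g => (g == IntPartN ln)%:R).
rewrite (bigD1 (IntPartN ln)) //= eqxx scale1r big1 ?addr0 // => g /negPf->.
by rewrite scale0r.
Qed.

(** By [extra_join], the product of two generators is again a generator, in the sum of the
    degrees. *)
Lemma span_extraM n m f g :
  span_extra n f -> span_extra m g -> span_extra (n + m) (f * g).
Proof.
move=> [c ->] [d ->]; rewrite mulr_suml.
under eq_bigr do rewrite -scalerAl.
apply: span_extra_sum => l _; rewrite mulr_sumr.
under eq_bigr do rewrite -scalerAr.
apply: span_extra_sum => g' _; rewrite -extra_join; apply: span_extra_mem.
rewrite /= (perm_sumn (s2 := l ++ g')) ?perm_sort // sumn_cat.
by rewrite (eqP (valP l)) (eqP (valP g')).
Qed.

Lemma span_extra1 : span_extra 0 1.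
Proof.
have ip0 : is_intpart [::] by [].
by have := @span_extra_mem 0 (IntPart ip0) erefl; rewrite extraE big_nil.
Qed.

Lemma span_extra_prod (I : Type) (r : seq I) (P : pred I) (k : I -> nat)
    (F : I -> cseries) : (forall i, P i -> span_extra (k i) (F i)) ->
  span_extra (\sum_(i <- r | P i) k i) (\prod_(i <- r | P i) F i).
Proof.
move=> PF; apply: (big_rec2 span_extra) => [|i a f /PF Fi sf]; first exact: span_extra1.
exact: span_extraM.
Qed.

(** Strong induction: [extra_blockE] is solved for [powsum n], and the remaining products only
    involve blocks smaller than [n], with sizes adding up to [n]. *)
Lemma span_extra_powsum n : (0 < n)%N -> span_extra n (powsum n).
Proof.
elim/ltn_ind: n => n IHn n0; have := extra_blockE n0 => /(canLR (addrK _)) <-.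
rewrite addrC -scaleN1r; apply: span_extra_lin.
  apply: span_extra_sum => sigma /andP[Ps ne].
  rewrite -[X in span_extra X](_ : \sum_(B in sigma) #|B| = n)%N; last first.
    by rewrite -(card_partition Ps) cardsT card_ord.
  apply: span_extra_prod => B Bs; apply: IHn; first exact: card_block_lt ne Bs.
  by rewrite card_gt0; apply: contraTneq Bs => ->; case/and3P: Ps.
have ipn : is_intpart [:: n] by rewrite /is_intpart /= inE eq_sym -lt0n.
by have := @span_extra_mem n (IntPart ipn) (addn0 n); rewrite extraE big_seq1.
Qed.

(** * Closure properties of symmetric functions *)

Lemma Sym_lin n a f g : Sym n f -> Sym n g -> Sym n (a *: f + g).
Proof.
move=> [df sf] [dg sg]; split=> [m|s bs m1 m2 m12]; last first.
  have -> : (a *: f + g) m2 = a * f m2 + g m2 by [].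
  by rewrite (sf s bs m1) // (sg s bs m1).
have -> : (a *: f + g) m = a * f m + g m by [].
have [-> |/df//] := eqVneq (f m) 0.
by rewrite mulr0 add0r => /dg.
Qed.

Lemma Sym0 n : Sym n 0.
Proof. by split=> // m /eqP. Qed.

Lemma Sym_sum n (I : Type) (r : seq I) (P : pred I) (c : I -> rat)
    (F : I -> cseries) : (forall i, P i -> Sym n (F i)) ->
  Sym n (\sum_(i <- r | P i) c i *: F i).
Proof.
move=> PF; apply: big_rec => [|i f /PF Fi sf]; first exact: Sym0.
exact: Sym_lin.
Qed.

Lemma mdeg_content w : mdeg (content w) = size w.
Proof.
rewrite /content mdeg_prod; under eq_bigr do rewrite mdegU.
by rewrite sum1_size.
Qed.

Lemma mdeg_xpow k i : mdeg (xpow k i) = k.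
Proof. by rewrite mdeg_content size_nseq. Qed.

Lemma Sym_powsum k : Sym k (powsum k).
Proof.
split=> [m|s [t st ts] m1 m2 m12].
  by rewrite /powsum; case: asboolP => [[i ->]|]; rewrite ?eqxx ?mdeg_xpow.
rewrite /powsum; congr ((nat_of_bool _)%:R); apply/asbool_equiv_eq.
split=> -[i E]; [exists (t i)|exists (s i)]; apply/eqP/cmP => j.
  by rewrite -m12 E !xpowE -(inj_eq (can_inj ts)) st.
by rewrite -[j]ts m12 E !xpowE (inj_eq (can_inj st)).
Qed.

(* The image of [m] under the substitution [x_i |-> x_(s i)]. *)
Definition mrename (s : nat -> nat) (m : {cmonom nat}) : {cmonom nat} :=
  content (FMonom [seq s i | i <- cmonom_seq m]).

Lemma mrenameE s t m i : cancel s t -> cancel t s -> mrename s m i = m (t i).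
Proof.
move=> st ts; rewrite contentE -[in RHS](count_cmonom_seq m) /= count_map.
by apply: eq_count => j /=; rewrite -{1}[i]ts (inj_eq (can_inj st)).
Qed.

(** Renaming variables carries the factorizations of [m1] bijectively onto those of [m2] and
    preserves the coefficients of both factors. *)
Lemma SymM n m f g : Sym n f -> Sym m g -> Sym (n + m) (f * g).
Proof.
move=> [df sf] [dg sg]; split=> [u|s bs m1 m2 m12].
  by case/seriesM_neq0 => -[p q] [<- /df <- /dg <-]; rewrite mdegM.
have [t st ts] := bs.
have rE u v i : cancel u v -> cancel v u -> mrename u (mrename v m1) i = m1 i.
  by move=> uv vu; rewrite !(mrenameE _ _ uv vu) (mrenameE _ _ vu uv) vu.
rewrite !seriesME (perm_big [seq (mrename s p.1, mrename s p.2) | p <- splits m1]) /=.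
  rewrite big_map; apply: eq_bigr => -[p q] _ /=.
  by rewrite (sf s bs p) ?(sg s bs q) // => i; rewrite (mrenameE _ _ st ts) st.
have rK u v : cancel u v -> cancel v u -> cancel (mrename u) (mrename v).
  move=> uv vu p; apply/eqP/cmP => i.
  by rewrite (mrenameE _ _ vu uv) (mrenameE _ _ uv vu) uv.
apply: uniq_perm; rewrite ?fset_uniq //.
  rewrite map_inj_uniq ?fset_uniq // => -[p q] [p' q'] /= [].
  by move=> /(can_inj (rK _ _ st ts))-> /(can_inj (rK _ _ st ts))->.
move=> [p q]; rewrite mem_splits; apply/eqP/mapP => /= [pq|[[p' q'] + [-> ->]]].
  exists (mrename t p, mrename t q); rewrite /= ?(rK _ _ ts st) // mem_splits.
  by apply/cmP => i; rewrite cmM !(mrenameE _ _ ts st) -cmM pq m12.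
rewrite mem_splits => /eqP /= E; apply/eqP/cmP => i.
by rewrite cmM !(mrenameE _ _ st ts) -cmM E -m12 ts.
Qed.

Lemma Sym1 : Sym 0 1.
Proof.
split=> [m|s [t st ts] m1 m2 m12]; rewrite !series1E.
  by have [->|] := eqVneq m mone; rewrite ?mdeg1 ?eqxx.
congr ((nat_of_bool _)%:R); apply/cmP/cmP => E i; rewrite cm1.
  by rewrite -m12 E cm1.
by rewrite -[i]ts m12 E cm1.
Qed.

Lemma Sym_prod (I : Type) (r : seq I) (P : pred I) (k : I -> nat)
    (F : I -> cseries) : (forall i, P i -> Sym (k i) (F i)) ->
  Sym (\sum_(i <- r | P i) k i) (\prod_(i <- r | P i) F i).
Proof.
move=> PF; apply: (big_rec2 Sym) => [|i a f /PF Fi sf]; first exact: Sym1.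
exact: SymM.
Qed.

Lemma Sym_extra_block n : (0 < n)%N -> Sym n (extra_block n).
Proof.
move=> n0; rewrite extra_blockE // -[powsum n]scale1r; apply: Sym_lin.
  exact: Sym_powsum.
apply: Sym_sum => sigma /andP[Ps _].
rewrite -[X in Sym X](_ : \sum_(B in sigma) #|B| = n)%N; last first.
  by rewrite -(card_partition Ps) cardsT card_ord.
by apply: Sym_prod => B _; apply: Sym_powsum.
Qed.

Lemma intpart_gt0 (l : intpart) a : a \in (l : seq nat) -> (0 < a)%N.
Proof.
by case: l => l /= /andP[_ l0] al; rewrite lt0n; apply: contraNneq l0 => <-.
Qed.

Lemma Sym_extra (l : intpart) : Sym (sumn l) (extra l).
Proof.
rewrite extraE sumnE big_seq [\prod_(_ <- _) _]big_seq; apply: Sym_prod => a /intpart_gt0.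
exact: Sym_extra_block.
Qed.

(** * Triangularity of products of power sums *)

(* [x_(g_0) ^ l_0 * x_(g_1) ^ l_1 * ...] *)
Definition zip_monomial (l g : seq nat) : {cmonom nat} :=
  \big[mmul/mone]_(p <- zip l g) xpow p.1 p.2.

Lemma zip_monomial_notin l g i : i \notin g -> zip_monomial l g i = 0%N.
Proof.
rewrite /zip_monomial cm_prod; elim: l g => [|a l IHl] [|x g] ni; rewrite ?big_nil //.
rewrite big_cons IHl; last by apply: contra ni; rewrite inE orbC => ->.
by move: ni; rewrite inE eq_sym negb_or xpowE /= => /andP[/negPf-> _]; rewrite muln0.
Qed.

(** Distinctness of the variables in [g] keeps the exponents from adding up. *)
Lemma map_zip_monomial l g : uniq g -> size g = size l ->
  [seq zip_monomial l g i | i <- g] = l.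
Proof.
elim: l g => [|a l IHl] [|x g] //= /andP[xg ug] [sg].
rewrite {1}/zip_monomial big_cons cmM -/(zip_monomial l g) zip_monomial_notin //.
rewrite xpowE eqxx muln1 addn0 -[in RHS](IHl g) //; congr (_ :: _).
apply/eq_in_map => i ig; rewrite /zip_monomial big_cons cmM xpowE /=.
by case: eqP => [xi|_]; rewrite ?muln0 // xi ig in xg *.
Qed.

Lemma finsupp_zip_monomial_sub l g : {subset finsupp (zip_monomial l g) <= g}.
Proof.
by move=> i; rewrite -cmE_neq0; apply: contraNT => /zip_monomial_notin->.
Qed.

Lemma finsupp_zip_monomial l g : uniq g -> size g = size l -> 0%N \notin l ->
  perm_eq (finsupp (zip_monomial l g)) g.
Proof.
move=> ug sg l0; apply: uniq_perm => // i; apply/idP/idP.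
  exact: finsupp_zip_monomial_sub.
move=> ig; rewrite -cmE_neq0; apply: contraNneq l0 => m0.
by rewrite -m0 -[X in _ \in X](map_zip_monomial ug sg) map_f.
Qed.

Definition powsums (l : seq nat) : cseries := \prod_(a <- l) powsum a.

(** Expanding the product picks one variable per part; [g] records the choices, possibly with
    repetitions. *)
Lemma powsums_neq0 l m : powsums l m != 0 ->
  exists2 g, size g = size l & m = zip_monomial l g.
Proof.
rewrite /powsums; elim: l m => [|a l IHl] m.
  rewrite big_nil series1E; have [-> _|_] := eqVneq m mone; last by rewrite eqxx.
  by exists [::]; rewrite // /zip_monomial big_nil.
rewrite big_cons => /seriesM_neq0[[p q] [/= <- + /IHl[g sg ->]]].
rewrite /powsum; case: asboolP => [[i ->] _|_]; last by rewrite eqxx.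
by exists (i :: g); rewrite /= ?sg // /zip_monomial big_cons.
Qed.

Lemma powsums_ge0 l m : 0 <= powsums l m.
Proof.
rewrite /powsums; elim: l m => [|a l IHl] m.
  by rewrite big_nil series1E; case: eqP.
rewrite big_cons seriesME; apply: sumr_ge0 => p _; exact: mulr_ge0.
Qed.

(** The choice of variables [g] contributes a positive term, and nonnegativity of all coefficients
    excludes cancellation. *)
Lemma powsums_gt0 l g : size g = size l -> 0 < powsums l (zip_monomial l g).
Proof.
elim: l g => [|a l IHl] [|x g] //=.
  by rewrite /powsums /zip_monomial !big_nil series1E eqxx.
case=> sg; rewrite /powsums /zip_monomial !big_cons seriesME.
rewrite (bigD1_seq (xpow a x, zip_monomial l g)) ?mem_splits ?fset_uniq //=.
apply: ltr_wpDr.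
  by apply: sumr_ge0 => p _; rewrite mulr_ge0 ?powsums_ge0.
rewrite mulr_gt0 ?IHl // /powsum; case: asboolP => // -[].
by exists x.
Qed.

(** The representative of the monomials with exponents [l] up to permutation of the variables. *)
Definition std_monomial (l : seq nat) := zip_monomial l (iota 0 (size l)).

Lemma std_monomialE l i : std_monomial l i = nth 0%N l i.
Proof.
have ug := iota_uniq 0 (size l); have sg := size_iota 0 (size l).
have [il|li] := ltnP i (size l).
  rewrite -{2}(map_zip_monomial ug sg) (nth_map 0%N) ?nth_iota ?sg //.
by rewrite nth_default // zip_monomial_notin // mem_iota -leqNgt.
Qed.

Lemma finsupp_std_monomial l : 0%N \notin l ->
  finsupp (std_monomial l) =i iota 0 (size l).
Proof.
by move=> l0; apply/perm_mem/finsupp_zip_monomial; rewrite ?iota_uniq ?size_iota.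
Qed.

Lemma powsums_std_le (l g : seq nat) : 0%N \notin g ->
  powsums l (std_monomial g) != 0 -> (size g <= size l)%N.
Proof.
move=> g0 /powsums_neq0[u <- E]; rewrite -[size g](size_iota 0).
apply: uniq_leq_size (iota_uniq _ _) _ => i.
by rewrite -finsupp_std_monomial // E; exact: finsupp_zip_monomial_sub.
Qed.

(** With as many variables as parts, the chosen variables are distinct, so the exponents are the
    parts of [l] up to order; sortedness then gives equality. *)
Lemma powsums_std_eq (l g : intpart) : size l = size g ->
  powsums l (std_monomial g) != 0 -> l = g.
Proof.
move=> slg /powsums_neq0[u su E].
have [/andP[sl l0] /andP[sg g0]] := (valP l, valP g).
have ui : perm_eq u (iota 0 (size g)).
  have iu : {subset iota 0 (size g) <= u}.
    move=> i; rewrite -finsupp_std_monomial // E.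
    exact: finsupp_zip_monomial_sub.
  have [|_ eqi] := uniq_min_size (iota_uniq _ _) iu; first by rewrite size_iota su slg.
  rewrite perm_sym uniq_perm ?iota_uniq //.
  by rewrite (leq_size_uniq (iota_uniq _ _) iu) // size_iota su slg.
have uu : uniq u by rewrite (perm_uniq ui) iota_uniq.
apply/val_inj/(sorted_eq (leT := geq)) => //.
- by move=> x y z yx xz; exact: leq_trans xz yx.
- by move=> x y; rewrite andbC -eqn_leq => /eqP.
rewrite -[val l](map_zip_monomial uu su).
rewrite -[val g](map_zip_monomial (iota_uniq 0 (size g)) (size_iota _ _)).
by rewrite -E; apply: perm_map.
Qed.

(** * Reduction of coefficients to standard monomials *)

Lemma extend_bijection (u : seq nat) : uniq u ->
  exists2 s : nat -> nat, bijective s & forall j, (j < size u)%N -> s (nth 0%N u j) = j.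
Proof.
elim/last_ind: u => [|u x IHu] /=; first by exists id; first exact: inv_bij.
rewrite rcons_uniq => /andP[xu /IHu[s bs sE]].
(* The transposition of [s x] and [size u]. It fixes every [j < size u]: if [s x] were such a [j],
   injectivity of [s] would put [x] in [u]. *)
pose t y := if y == s x then size u else if y == size u then s x else y.
have tt : involutive t.
  move=> y; rewrite /t; have [->|ny] := eqVneq y (s x).
    by case: eqP => // _; rewrite eqxx.
  have [->|ny'] := eqVneq y (size u); first by rewrite eqxx.
  by rewrite (negPf ny) (negPf ny').
exists (t \o s); first exact: bij_comp (inv_bij tt) bs.
move=> j; rewrite size_rcons ltnS nth_rcons /= leq_eqVlt => /orP[/eqP->|ju].
  by rewrite ltnn eqxx /t eqxx.
rewrite ju sE // /t; case: eqP => [jx|_]; last by rewrite ltn_eqF.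
by case/negP: xu; rewrite -(bij_inj bs (etrans (sE _ ju) jx)) mem_nth.
Qed.

(** Sorting the variables of [m] by decreasing exponent and renaming them to the initial ones gives
    a standard monomial; symmetry preserves the coefficient. *)
Lemma Sym_std n f m : Sym n f -> f m != 0 ->
  exists2 l : intpartn n, size l = size (finsupp m) & f (std_monomial l) = f m.
Proof.
move=> [df sf] fm; have mn := df m fm.
pose u := sort (fun i j => (m j <= m i)%N) (finsupp m).
have pu : perm_eq u (finsupp m) by rewrite perm_sort.
have uu : uniq u by rewrite (perm_uniq pu).
have mu : is_intpart (map m u).
  apply/andP; split.
    by rewrite sorted_map; apply: sort_sorted => x y; exact: leq_total.
  apply/mapP => -[i]; rewrite (perm_mem pu) -cmE_neq0 => mi /esym/eqP.
  by rewrite (negPf mi).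
have su : sumn (IntPart mu) == n.
  by rewrite /= sumnE big_map (perm_big _ pu) -mn mdegE.
exists (IntPartN su); first by rewrite /= size_map (perm_size pu).
have [s bs sE] := extend_bijection uu.
apply: (sf s bs) => i; rewrite std_monomialE /=.
have [im|im] := boolP (i \in finsupp m).
  rewrite -(perm_mem pu) in im; rewrite -{1}(nth_index 0%N im) sE ?index_mem //.
  by rewrite (nth_map 0%N) ?index_mem // nth_index.
(* Outside the support, [s i] cannot be below [size u], since these values are already taken by the
   elements of [u]. *)
rewrite [RHS](fsfun_dflt im); have [lt|?] := ltnP (s i) (size u).
  by rewrite -(bij_inj bs (sE _ lt)) -(perm_mem pu) mem_nth in im.
by rewrite nth_default ?size_map.
Qed.

(** * Spanning and linear independence *)

Lemma Sym_powsums (l : seq nat) : Sym (sumn l) (powsums l).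
Proof. by rewrite /powsums sumnE; apply: Sym_prod => a _; apply: Sym_powsum. Qed.

Lemma span_extra_powsums (l : intpart) : span_extra (sumn l) (powsums l).
Proof.
rewrite /powsums sumnE big_seq [\prod_(_ <- _) _]big_seq.
by apply: span_extra_prod => a /intpart_gt0; apply: span_extra_powsum.
Qed.

Lemma intpart_notin0 (l : intpart) : 0%N \notin (l : seq nat).
Proof. by case/andP: (valP l). Qed.

(* Subtracting a combination of the power sums with [k] parts kills the
   monomials with [k] variables, without reaching those with more. *)
Lemma Sym_span n f : Sym n f -> span_extra n f.
Proof.
(* [K] exceeds the number of parts of every partition of [n], so the bound [fK] always holds; it is
   then generalized to start the induction. *)
pose K := (\max_(l : intpartn n) size l).+1.
have fK : Sym n f -> forall l : intpartn n, f (std_monomial l) != 0 -> (size l < K)%N.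
  by move=> _ l _; rewrite ltnS; apply: (leq_bigmax l).
move=> Sf; move: (fK Sf) => {fK}; move: K => k.
elim: k f Sf => [|k IHk] f Sf fk.
  rewrite (_ : f = 0); first exact: span_extra0.
  apply/funext => m; apply/eqP; apply: contraT => fm.
  have [l _ fl] := Sym_std Sf fm.
  by have := fk l; rewrite fl => /(_ fm).
(* Division by the positive diagonal entry makes [g] agree with [f] at the standard monomials with
   [k] variables. *)
pose c (l : intpartn n) := f (std_monomial l) / powsums l (std_monomial l).
pose g : cseries := \sum_(l : intpartn n | size l == k) c l *: powsums l.
have gS : Sym n g.
  by apply: Sym_sum => l _; have := Sym_powsums l; rewrite (eqP (valP l)).
have gs : span_extra n g.
  by apply: span_extra_sum => l _; have := span_extra_powsums l; rewrite (eqP (valP l)).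
have -> : f = 1 *: ((- 1) *: g + f) + g by rewrite scale1r scaleN1r addrAC addNr add0r.
apply: span_extra_lin => //; apply: IHk => [|l]; first exact: Sym_lin.
have -> : ((-1) *: g + f) (std_monomial l) = f (std_monomial l) - g (std_monomial l).
  by rewrite scaleN1r addrC.
apply: contraNT; rewrite -leqNgt => kl.
have gE (h : intpartn n) : (c h *: powsums h) (std_monomial l) =
    c h * powsums h (std_monomial l) by [].
rewrite subr_eq0 /g series_sumE.
have [slk|slk] := eqVneq (size l) k.
  rewrite (bigD1 l) ?slk //= gE divfK; last first.
    by rewrite gt_eqF // powsums_gt0 // size_iota.
  rewrite big1 ?addr0 // => h /andP[/eqP sh hl]; rewrite gE.
  have [->|] := eqVneq (powsums h (std_monomial l)) 0; first by rewrite mulr0.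
  move/powsums_std_eq => hl'; case/eqP: hl; apply/val_inj/hl'.
  by rewrite sh slk.
(* With more than [k] variables, [f] vanishes by [fk] and every term of [g] by [powsums_std_le]. *)
rewrite big1 => [|h /eqP sh].
  by apply: contraT => /fk; rewrite ltnS leq_eqVlt (negPf slk) ltnNge kl.
rewrite gE; have [->|] := eqVneq (powsums h (std_monomial l)) 0; first by rewrite mulr0.
move/(powsums_std_le (intpart_notin0 l)); rewrite sh => lk.
by case/eqP: slk; apply/eqP; rewrite eqn_leq lk.
Qed.

(** Coefficients at standard monomials give square matrices [P] for the power sums and [X] for the
    [x_lambda]. [P] is invertible by triangularity and factors through [X], so [X] is invertible
    too, which forces any relation to be trivial. *)
Lemma extra_free n (c : intpartn n -> rat) :
  \sum_l c l *: extra l = 0 -> forall l, c l = 0.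
Proof.
pose I : finType := intpartn n.
pose evalmx (F : I -> cseries) : 'M[rat]_#|I| :=
  \matrix_(i, j) F (enum_val i) (std_monomial (enum_val j : I)).
pose P := evalmx (fun l => powsums l); pose X := evalmx (fun l => extra l).
have Punit : P \in unitmx.
  rewrite -row_free_unit; apply: inj_row_free => v vP.
  apply/eqP; apply: contraT => /matrix0Pn[i0 [j0]]; rewrite ord1 => vj0.
  (* Among the nonzero entries of [v], one whose partition has most parts is chosen: in column [j]
     of [P], triangularity then leaves only the diagonal term of [v *m P]. *)
  have [j vj jmax] := arg_maxnP (P := fun j => v 0 j != 0)
    (fun j => size (enum_val j : I)) vj0.
  have /rowP/(_ j) := vP; rewrite !mxE (bigD1 j) //= big1.
    rewrite addr0 mxE => /eqP; rewrite mulf_eq0 (negPf vj) /=.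
    by rewrite gt_eqF // powsums_gt0 // size_iota.
  move=> i ij; rewrite mxE.
  have [->|vi] := eqVneq (v 0 i) 0; first by rewrite mul0r.
  have [->|Pi] := eqVneq (powsums (enum_val i : I) (std_monomial (enum_val j : I))) 0.
    by rewrite mulr0.
  have s1 := powsums_std_le (intpart_notin0 _) Pi.
  have s2 := jmax i vi.
  case/eqP: ij; apply/enum_val_inj/val_inj/powsums_std_eq => //.
  by apply/eqP; rewrite eqn_leq s1 andbT.
have spanP (l : I) : exists v : I -> rat, powsums l = \sum_g v g *: extra (g : I).
  by have := span_extra_powsums l; rewrite (eqP (valP l)).
have [V VE] := choice spanP.
have evalE (a : I -> rat) m : (\sum_g a g *: extra (g : I)) m =
    \sum_(i < #|I|) a (enum_val i) * extra (enum_val i : I) m.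
  rewrite series_sumE (reindex (@enum_val _ (mem I))) //=.
  by apply: onW_bij; exact: enum_val_bij.
have PX : P = (\matrix_(i, j) V (enum_val i) (enum_val j)) *m X.
  apply/matrixP => i j; rewrite !mxE VE evalE.
  by apply: eq_bigr => k _; rewrite !mxE.
have Xunit : X \in unitmx by move: Punit; rewrite PX unitmx_mul => /andP[].
move=> cX l; pose r : 'rV_#|I| := \row_i c (enum_val i).
have rX : r *m X = 0.
  apply/rowP => j; rewrite !mxE.
  rewrite -[RHS](congr1 (fun f : cseries => f (std_monomial (enum_val j : I))) cX).
  by rewrite evalE; apply: eq_bigr => i _; rewrite !mxE.
have /rowP/(_ (enum_rank l)) : r = 0 by rewrite -[r](mulmxK Xunit) rX mul0mx.
by rewrite !mxE enum_rankK.
Qed.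

Theorem proposition3p5 :
  (forall n : nat, (1 <= n)%N ->
     is_basis (Sym n) (fun l : intpartn n => extra l)) /\
  (forall l g : intpart, extra l * extra g = extra (intpart_join l g)).
Proof.
split=> [n _|l g]; last by rewrite extra_join.
split=> [l|c|f Sf]; last exact: Sym_span.
  by have := Sym_extra l; rewrite (eqP (valP l)).
exact: extra_free.
Qed.
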